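(* Let $(M,J,g)$ be a locally metallic Riemannian manifold with $J^2=pJ+qI$, $p,q\in\mathbb R$, and let $\nabla$ be the Levi-Civita connection of $g$. Then the generalized product structure $\hat J_p:=\begin{pmatrix} J & (I-J^2)\sharp_g\\ \flat_g & -J^*\end{pmatrix}$ on $TM\oplus T^*M$, i.e. $\hat J_p(X+\alpha)=JX+(I-J^2)\sharp_g\alpha+\flat_gX-J^*\alpha$, is $\nabla$-integrable.
   Context: A metallic Riemannian manifold $(M,J,g)$ is a smooth manifold with a $(1,1)$-tensor field $J$ satisfying $J^2=pJ+qI$ and a Riemannian metric $g$ with $g(JX,Y)=g(X,JY)$ for all vector fields $X,Y$. It is locally metallic if $\nabla J=0$ for the Levi-Civita connection $\nabla$ of $g$. $\flat_g:TM\to T^*M$, $\flat_g(X):=i_Xg$, and $\sharp_g$ is its inverse; $(J^*\alpha)(X):=\alpha(JX)$. $\hat J_p$ satisfies $\hat J_p^2=I$. The bracket on $C^\infty(TM\oplus T^*M)$ is $[X+\alpha,Y+\beta]_\nabla:=[X,Y]+\nabla_X\beta-\nabla_Y\alpha$. An endomorphism $\hat J$ of $TM\oplus T^*M$ is $\nabla$-integrable if $N^\nabla_{\hat J}(\sigma,\tau):=[\hat J\sigma,\hat J\tau]_\nabla-\hat J[\hat J\sigma,\tau]_\nabla-\hat J[\sigma,\hat J\tau]_\nabla+\hat J^2[\sigma,\tau]_\nabla$ vanishes for all $\sigma,\tau\in C^\infty(TM\oplus T^*M)$. *)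

(* Defs.v *)
From HB Require Import structures.
From mathcomp Require Import all_boot all_order all_algebra.
From mathcomp Require Import all_classical all_reals all_analysis.
Import GRing.Theory Num.Theory.
Import numFieldNormedType.Exports.

Set Implicit Arguments.
Unset Strict Implicit.
Unset Printing Implicit Defensive.

Local Open Scope classical_set_scope.
Local Open Scope ring_scope.

Section Ck.
Variables (R : realType) (n : nat).
Implicit Types (U : set 'rV[R]_n) (f g : 'rV[R]_n -> R).

Definition partial (i : 'I_n) f : 'rV[R]_n -> R :=
  fun x => 'D_(delta_mx 0 i : 'rV[R]_n) (f : 'rV[R]_n -> R^o) x.

(* [f] is total: only its values on the open set [U] matter. *)
Fixpoint Ck_on U (k : nat) f : Prop :=
  (forall x, U x -> {for x, continuous f}) /\
  (if k is k'.+1 then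
     forall i : 'I_n,
       (forall x, U x ->
          derivable (f : 'rV[R]_n -> R^o) x (delta_mx 0 i : 'rV[R]_n)) /\
       Ck_on U k' (partial i f)
   else True).

Definition smooth_on U f : Prop := forall k, Ck_on U k f.

End Ck.

Record chart (R : realType) (n : nat) (M : topologicalType) := Chart {
  chart_dom : set M;
  chart_map :> M -> 'rV[R]_n;
  chart_inv : 'rV[R]_n -> M;
  chart_dom_open : open chart_dom;
  chart_img_open : open (chart_map @` chart_dom);
  chart_mapK : forall x, chart_dom x -> chart_inv (chart_map x) = x;
  chart_map_cont : forall x, chart_dom x -> {for x, continuous chart_map};
  chart_inv_cont : forall y, (chart_map @` chart_dom) y ->
    {for y, continuous chart_inv}
}.

Definition chart_compatible (R : realType) (n : nat) (M : topologicalType)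
    (phi psi : chart R n M) : Prop :=
  forall j : 'I_n,
    smooth_on (phi @` (chart_dom phi `&` chart_dom psi))
      (fun y => psi (chart_inv phi y) 0 j).

(* The atlas need not be maximal: it determines the smooth structure. *)
HB.mixin Record isSmoothManifold (R : realType) (n : nat) M
    of Topological M := {
  atlas : set (chart R n M);
  atlas_cover : forall x : M, exists2 phi, atlas phi & chart_dom phi x;
  atlas_compatible : forall phi psi, atlas phi -> atlas psi ->
    chart_compatible phi psi;
  manifold_hausdorff : hausdorff_space M;
  manifold_second_countable : @second_countable M
}.

#[short(type="smoothManifoldType")]
HB.structure Definition SmoothManifold (R : realType) (n : nat) :=
  {M of Topological M & isSmoothManifold R n M}.

Section Algebra.
Variables (R : realType) (n : nat).

Section CkTheory.
Implicit Types (U : set 'rV[R]_n) (f g : 'rV[R]_n -> R).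

Lemma Ck_on_eq U k f g : open U -> (forall x, U x -> f x = g x) ->
  Ck_on U k f -> Ck_on U k g.
Proof.
move=> oU; elim: k f g => [|k IH] f g fg /=.
  case=> cf _; split=> // x Ux.
  have nfg : \forall y \near x, f y = g y.
    by apply: filterS (open_nbhs_nbhs (conj oU Ux)) => y /fg.
  rewrite /prop_for /continuous_at -(fg _ Ux).
  exact: (cvg_trans (near_eq_cvg nfg) (cf _ Ux)).
case=> cf df; split.
  move=> x Ux.
  have nfg : \forall y \near x, f y = g y.
    by apply: filterS (open_nbhs_nbhs (conj oU Ux)) => y /fg.
  rewrite /prop_for /continuous_at -(fg _ Ux).
  exact: (cvg_trans (near_eq_cvg nfg) (cf _ Ux)).
move=> i; have [d1 d2] := df i.
have nfg x : U x -> \forall y \near x, (f : _ -> R^o) y = g y.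
  by move=> Ux; apply: filterS (open_nbhs_nbhs (conj oU Ux)) => y /fg.
split=> [x Ux|].
  by apply: near_eq_derivable (d1 _ Ux); apply: nfg.
apply: IH d2 => x Ux; rewrite /partial.
by apply: near_eq_derive; apply: nfg.
Qed.

Lemma Ck_on_S U k f : Ck_on U k.+1 f -> Ck_on U k f.
Proof.
elim: k f => [|k IH] f; first by case.
by case=> cf df; split=> // i; have [? ?] := df i; split=> //; apply: IH.
Qed.

Lemma Ck_on_cst U k (c : R) : open U -> Ck_on U k (fun=> c).
Proof.
move=> oU; elim: k c => [|k IH] c /=.
  by split=> // x _; exact: (@cst_continuous _ _ c x).
split=> [x _|i]; first exact: (@cst_continuous _ _ c x).
split=> [x _|]; first exact: derivable_cst.
apply: Ck_on_eq (IH 0) => // x _.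
by rewrite /partial derive_cst.
Qed.

Lemma Ck_onD U k f g : open U -> Ck_on U k f -> Ck_on U k g ->
  Ck_on U k (f \+ g).
Proof.
move=> oU; elim: k f g => [|k IH] f g /= [cf df] [cg dg].
  by split=> // x Ux; apply: continuousD; [apply: cf | apply: cg].
split=> [x Ux|i]; first by apply: continuousD; [apply: cf | apply: cg].
have [df1 df2] := df i; have [dg1 dg2] := dg i.
split=> [x Ux|]; first by apply: derivableD; [apply: df1 | apply: dg1].
apply: Ck_on_eq (IH _ _ df2 dg2) => // x Ux.
by rewrite /partial deriveD//; [apply: df1 | apply: dg1].
Qed.

Lemma Ck_onM U k f g : open U -> Ck_on U k f -> Ck_on U k g ->
  Ck_on U k (f \* g).
Proof.
move=> oU; elim: k f g => [|k IH] f g.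
  by move=> [cf _] [cg _]; split=> // x Ux; apply: continuousM; [apply: cf | apply: cg].
move=> Cf Cg; have [cf df] := Cf; have [cg dg] := Cg.
split=> [x Ux|i]; first by apply: continuousM; [apply: cf | apply: cg].
have [df1 df2] := df i; have [dg1 dg2] := dg i.
split=> [x Ux|].
  by apply: (derivableM (f := f) (g := g)); [apply: df1 | apply: dg1].
have C1 := IH _ _ (Ck_on_S Cf) dg2; have C2 := IH _ _ (Ck_on_S Cg) df2.
apply: Ck_on_eq (Ck_onD oU C1 C2) => // x Ux.
rewrite /partial /=.
by rewrite (deriveM (df1 _ Ux) (dg1 _ Ux)).
Qed.

End CkTheory.

Variable M : smoothManifoldType R n.

Definition smooth (f : M -> R) : Prop :=
  forall phi : chart R n M, atlas phi ->
    smooth_on (phi @` chart_dom phi) (f \o chart_inv phi).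

Definition smooth_pred : {pred M -> R} := fun f => `[< smooth f >].

Fact smooth_subring : subring_closed smooth_pred.
Proof.
have S1 : smooth 1.
  by move=> phi _ k; apply: Ck_on_cst; apply: chart_img_open.
have SN1 : smooth (-1).
  by move=> phi _ k; apply: (@Ck_on_cst _ _ (- 1)); apply: chart_img_open.
have SD f g : smooth f -> smooth g -> smooth (f + g).
  move=> sf sg phi aphi k.
  by apply: Ck_onD; [apply: chart_img_open | apply: sf | apply: sg].
have SM f g : smooth f -> smooth g -> smooth (f * g).
  move=> sf sg phi aphi k.
  by apply: Ck_onM; [apply: chart_img_open | apply: sf | apply: sg].
split; first exact/asboolP.
- move=> f g /asboolP sf /asboolP sg; apply/asboolP.
  by rewrite -mulN1r; apply: SD => //; apply: SM.
- by move=> f g /asboolP sf /asboolP sg; apply/asboolP; apply: SM.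
Qed.

HB.instance Definition _ :=
  GRing.isSubringClosed.Build (M -> R) smooth_pred smooth_subring.

(* The ring C^oo(M); it is the zero ring if [M] is empty. *)
Record smoothFun := SmoothFun {
  smooth_val :> M -> R;
  smooth_valP : smooth_val \in smooth_pred
}.

HB.instance Definition _ := [isSub for smooth_val].
HB.instance Definition _ := [Choice of smoothFun by <:].
HB.instance Definition _ := GRing.SubChoice_isSubComPzRing.Build
  (M -> R) smooth_pred smoothFun smooth_subring.

Fact smooth_cst_subproof (c : R) : (fun=> c : R) \in smooth_pred.
Proof.
by apply/asboolP => phi _ k; apply: Ck_on_cst; apply: chart_img_open.
Qed.

Definition smooth_cst (c : R) : smoothFun := SmoothFun (smooth_cst_subproof c).

(* A vector field is given by its action on smooth functions: its value at x
   is the point derivation f |-> (X f) x of C^oo(M), and it is a smooth field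
   because X f is smooth for every smooth f. *)
Record vectorField := VectorField {
  vf_fun :> smoothFun -> smoothFun;
  vf_linear : forall (c : R) f g,
    vf_fun (smooth_cst c * f + g) = smooth_cst c * vf_fun f + vf_fun g;
  vf_leibniz : forall f g, vf_fun (f * g) = f * vf_fun g + vf_fun f * g
}.

Implicit Types (c : R) (f h k : smoothFun) (X Y Z : vectorField).

Lemma vf_eqP X Y : (forall f, X f = Y f) -> X = Y.
Proof.
case: X Y => [X lX dX] [Y lY dY] /= XY.
have E : X = Y by apply/funext.
by subst Y; congr VectorField; apply: Prop_irrelevance.
Qed.

HB.instance Definition _ := gen_eqMixin vectorField.
HB.instance Definition _ := gen_choiceMixin vectorField.

Fact vf0_linear c f k : 0 = smooth_cst c * 0 + 0 :> smoothFun.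
Proof. by rewrite mulr0 addr0. Qed.
Fact vf0_leibniz f k : 0 = f * 0 + 0 * k :> smoothFun.
Proof. by rewrite mulr0 mul0r addr0. Qed.
Definition vf_zero := VectorField vf0_linear vf0_leibniz.

Fact vfD_linear X Y c f k : X (smooth_cst c * f + k) + Y (smooth_cst c * f + k)
  = smooth_cst c * (X f + Y f) + (X k + Y k).
Proof. by rewrite !vf_linear mulrDr addrACA. Qed.
Fact vfD_leibniz X Y f k :
  X (f * k) + Y (f * k) = f * (X k + Y k) + (X f + Y f) * k.
Proof. by rewrite !vf_leibniz mulrDr mulrDl addrACA. Qed.
Definition vf_add X Y := VectorField (vfD_linear X Y) (vfD_leibniz X Y).

Fact vfN_linear X c f k : - X (smooth_cst c * f + k)
  = smooth_cst c * (- X f) + (- X k).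
Proof. by rewrite !vf_linear opprD mulrN. Qed.
Fact vfN_leibniz X f k : - X (f * k) = f * (- X k) + (- X f) * k.
Proof. by rewrite !vf_leibniz opprD mulrN mulNr. Qed.
Definition vf_opp X := VectorField (vfN_linear X) (vfN_leibniz X).

Fact vfZ_linear h X c f k : h * X (smooth_cst c * f + k)
  = smooth_cst c * (h * X f) + (h * X k).
Proof. by rewrite !vf_linear mulrDr mulrCA. Qed.
Fact vfZ_leibniz h X f k : h * X (f * k) = f * (h * X k) + (h * X f) * k.
Proof. by rewrite !vf_leibniz mulrDr mulrCA -mulrA. Qed.
Definition vf_scale h X := VectorField (vfZ_linear h X) (vfZ_leibniz h X).

Fact vf_addA : associative vf_add.
Proof. by move=> X Y Z; apply: vf_eqP => f /=; rewrite addrA. Qed.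
Fact vf_addC : commutative vf_add.
Proof. by move=> X Y; apply: vf_eqP => f /=; rewrite addrC. Qed.
Fact vf_add0 : left_id vf_zero vf_add.
Proof. by move=> X; apply: vf_eqP => f /=; rewrite add0r. Qed.
Fact vf_addN : left_inverse vf_zero vf_opp vf_add.
Proof. by move=> X; apply: vf_eqP => f /=; rewrite addNr. Qed.
HB.instance Definition _ :=
  GRing.isZmodule.Build vectorField vf_addA vf_addC vf_add0 vf_addN.

Fact vf_scaleA h k X : vf_scale h (vf_scale k X) = vf_scale (h * k) X.
Proof. by apply: vf_eqP => f /=; rewrite mulrA. Qed.
Fact vf_scale1 : left_id 1 vf_scale.
Proof. by move=> X; apply: vf_eqP => f /=; rewrite mul1r. Qed.
Fact vf_scaleDr : right_distributive vf_scale +%R.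
Proof. by move=> h X Y; apply: vf_eqP => f /=; rewrite mulrDr. Qed.
Fact vf_scaleDl X : {morph vf_scale^~ X : h k / h + k}.
Proof. by move=> h k; apply: vf_eqP => f /=; rewrite mulrDl. Qed.
HB.instance Definition _ := GRing.Zmodule_isLmodule.Build smoothFun vectorField
  vf_scaleA vf_scale1 vf_scaleDr vf_scaleDl.

Fact vfB_linear X Y c f k : X (Y (smooth_cst c * f + k)) -
  Y (X (smooth_cst c * f + k)) =
  smooth_cst c * (X (Y f) - Y (X f)) + (X (Y k) - Y (X k)).
Proof. by rewrite !vf_linear mulrBr opprD addrACA. Qed.

Lemma vf_additive X f k : X (f + k) = X f + X k.
Proof.
have c1 : smooth_cst 1 = 1 by apply: val_inj.
by have := vf_linear X 1 f k; rewrite c1 !mul1r.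
Qed.

Fact vfB_leibniz X Y f k : X (Y (f * k)) - Y (X (f * k)) =
  f * (X (Y k) - Y (X k)) + (X (Y f) - Y (X f)) * k.
Proof.
have E (A B C D A' D' : smoothFun) :
    A + B + (C + D) - (A' + C + (B + D')) = A - A' + (D - D').
  rewrite [C + D]addrC addrACA [B + D']addrC [A' + C + _]addrACA [C + B]addrC.
  by rewrite [A' + D' + _]addrC addrKA opprD addrACA.
by rewrite !vf_leibniz !vf_additive !vf_leibniz mulrBr mulrBl E.
Qed.

Definition lie X Y := VectorField (vfB_linear X Y) (vfB_leibniz X Y).

(* Tensor fields are identified with C^oo(M)-multilinear maps on sections:
   being C^oo(M)-linear, such maps act pointwise. *)
Record oneForm := OneForm {
  form_fun :> vectorField -> smoothFun;
  form_linear : forall f X Y,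
    form_fun (f *: X + Y) = f * form_fun X + form_fun Y
}.

Implicit Types a b : oneForm.

Lemma form_eqP a b : (forall X, a X = b X) -> a = b.
Proof.
case: a b => [a la] [b lb] /= ab.
have E : a = b by apply/funext.
by subst b; congr OneForm; apply: Prop_irrelevance.
Qed.

HB.instance Definition _ := gen_eqMixin oneForm.
HB.instance Definition _ := gen_choiceMixin oneForm.

Fact form0_linear f X Y : 0 = f * 0 + 0 :> smoothFun.
Proof. by rewrite mulr0 addr0. Qed.
Definition form_zero := OneForm form0_linear.

Fact formD_linear a b f X Y : a (f *: X + Y) + b (f *: X + Y)
  = f * (a X + b X) + (a Y + b Y).
Proof. by rewrite !form_linear mulrDr addrACA. Qed.
Definition form_add a b := OneForm (formD_linear a b).

Fact formN_linear a f X Y : - a (f *: X + Y) = f * (- a X) + (- a Y).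
Proof. by rewrite !form_linear opprD mulrN. Qed.
Definition form_opp a := OneForm (formN_linear a).

Fact formZ_linear h a f X Y : h * a (f *: X + Y) = f * (h * a X) + (h * a Y).
Proof. by rewrite !form_linear mulrDr mulrCA. Qed.
Definition form_scale h a := OneForm (formZ_linear h a).

Fact form_addA : associative form_add.
Proof. by move=> a b c; apply: form_eqP => X /=; rewrite addrA. Qed.
Fact form_addC : commutative form_add.
Proof. by move=> a b; apply: form_eqP => X /=; rewrite addrC. Qed.
Fact form_add0 : left_id form_zero form_add.
Proof. by move=> a; apply: form_eqP => X /=; rewrite add0r. Qed.
Fact form_addN : left_inverse form_zero form_opp form_add.
Proof. by move=> a; apply: form_eqP => X /=; rewrite addNr. Qed.
HB.instance Definition _ :=
  GRing.isZmodule.Build oneForm form_addA form_addC form_add0 form_addN.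

Fact form_scaleA h k a : form_scale h (form_scale k a) = form_scale (h * k) a.
Proof. by apply: form_eqP => X /=; rewrite mulrA. Qed.
Fact form_scale1 : left_id 1 form_scale.
Proof. by move=> a; apply: form_eqP => X /=; rewrite mul1r. Qed.
Fact form_scaleDr : right_distributive form_scale +%R.
Proof. by move=> h a b; apply: form_eqP => X /=; rewrite mulrDr. Qed.
Fact form_scaleDl a : {morph form_scale^~ a : h k / h + k}.
Proof. by move=> h k; apply: form_eqP => X /=; rewrite mulrDl. Qed.
HB.instance Definition _ := GRing.Zmodule_isLmodule.Build smoothFun oneForm
  form_scaleA form_scale1 form_scaleDr form_scaleDl.

Lemma form_additive a X Y : a (X + Y) = a X + a Y.
Proof. by have := form_linear a 1 X Y; rewrite scale1r mul1r. Qed.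

Definition tensor11 := {linear vectorField -> vectorField}.

(* [metric_def]: if g_x(X_x, X_x) = 0 then the tangent vector X_x is zero. *)
Record riemannianMetric := RiemannianMetric {
  metric_fun :> vectorField -> vectorField -> smoothFun;
  metric_linear : forall f X Y Z,
    metric_fun (f *: X + Y) Z = f * metric_fun X Z + metric_fun Y Z;
  metric_sym : forall X Y, metric_fun X Y = metric_fun Y X;
  metric_ge0 : forall X (x : M), 0 <= metric_fun X X x;
  metric_def : forall X (x : M), metric_fun X X x = 0 -> forall f, X f x = 0
}.

Record connection := Connection {
  conn_fun :> vectorField -> vectorField -> vectorField;
  conn_linear : forall f X Y Z,
    conn_fun (f *: X + Y) Z = f *: conn_fun X Z + conn_fun Y Z;
  conn_additive : forall X Y Z, conn_fun X (Y + Z) = conn_fun X Y + conn_fun X Z;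
  conn_leibniz : forall X f Y, conn_fun X (f *: Y) = X f *: Y + f *: conn_fun X Y
}.

Implicit Types (J : tensor11) (g : riemannianMetric) (nabla : connection).

Definition levi_civita g nabla : Prop :=
  (forall X Y, nabla X Y - nabla Y X = lie X Y) /\
  (forall X Y Z, X (g Y Z) = g (nabla X Y) Z + g Y (nabla X Z)).

Definition metallic_riemannian (p q : R) J g : Prop :=
  (forall X, J (J X) = smooth_cst p *: J X + smooth_cst q *: X) /\
  (forall X Y, g (J X) Y = g X (J Y)).

Definition nabla_tensor11 nabla J X Y : vectorField :=
  nabla X (J Y) - J (nabla X Y).

Definition locally_metallic nabla J : Prop :=
  forall X Y, nabla_tensor11 nabla J X Y = 0.

Fact nabla_form_linear nabla X b f Y Z :
  X (b (f *: Y + Z)) - b (nabla X (f *: Y + Z)) =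
  f * (X (b Y) - b (nabla X Y)) + (X (b Z) - b (nabla X Z)).
Proof.
rewrite conn_additive conn_leibniz -addrA !form_linear vf_additive vf_leibniz.
rewrite mulrBr [f * X (b Y) + _]addrC -[X f * _ + _ + _]addrA.
by rewrite [X f * _ + (f * X _ + _)]addrC addrKA opprD addrACA.
Qed.
Definition nabla_form nabla X b := OneForm (nabla_form_linear nabla X b).

Fact flat_form_linear g X f Y Z : g X (f *: Y + Z) = f * g X Y + g X Z.
Proof. by rewrite metric_sym metric_linear ![g _ X]metric_sym. Qed.
Definition flat g X := OneForm (flat_form_linear g X).

Fact flat_linear g : linear (flat g).
Proof. by move=> f X Y; apply: form_eqP => Z; apply: metric_linear. Qed.
HB.instance Definition _ g :=
  GRing.isLinear.Build smoothFun vectorField oneForm *:%R (flat g)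
    (flat_linear g).

Fact dual_form_linear J a f X Y : a (J (f *: X + Y)) = f * a (J X) + a (J Y).
Proof. by rewrite linearP form_linear. Qed.
Definition dual J a := OneForm (dual_form_linear J a).

Fact dual_linear J : linear (dual J).
Proof. by move=> f a b; apply: form_eqP. Qed.
HB.instance Definition _ J :=
  GRing.isLinear.Build smoothFun oneForm oneForm *:%R (dual J) (dual_linear J).

(* Sections of the direct sum of TM and T^*M; an endomorphism of this bundle
   is a C^oo(M)-linear map on genSection. *)
Definition genSection := (vectorField * oneForm)%type.
HB.instance Definition _ := GRing.Lmodule.on genSection.

Implicit Types s t : genSection.

Definition nabla_bracket nabla s t : genSection :=
  (lie s.1 t.1, nabla_form nabla s.1 t.2 - nabla_form nabla t.1 s.2).

Definition nijenhuis nabla (K : {linear genSection -> genSection}) s t :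
    genSection :=
  nabla_bracket nabla (K s) (K t) - K (nabla_bracket nabla (K s) t)
  - K (nabla_bracket nabla s (K t)) + K (K (nabla_bracket nabla s t)).

Definition nabla_integrable nabla (K : {linear genSection -> genSection}) :
    Prop :=
  forall s t, nijenhuis nabla K s t = 0.

(* [sharp] is meant to be the inverse of [flat g]. *)
Definition hatJp J g (sharp : {linear oneForm -> vectorField}) s : genSection :=
  (J s.1 + (sharp s.2 - J (J (sharp s.2))), flat g s.1 - dual J s.2).

Fact hatJp_linear J g (sharp : {linear oneForm -> vectorField}) :
  linear (hatJp J g sharp).
Proof.
move=> f s t; congr pair; rewrite /= !linearP /= !scalerDr.
  by rewrite [X in _ + X = _]addrACA [LHS]addrACA.
by rewrite addrACA.
Qed.
HB.instance Definition _ J g (sharp : {linear oneForm -> vectorField}) :=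
  GRing.isLinear.Build smoothFun genSection genSection *:%R (hatJp J g sharp)
    (hatJp_linear J g sharp).

Lemma hatJp_product J g (sharp : {linear oneForm -> vectorField}) :
  (forall X Y, g (J X) Y = g X (J Y)) ->
  cancel (flat g) sharp -> cancel sharp (flat g) ->
  involutive (hatJp J g sharp).
Proof.
move=> gJ flatK sharpK.
have sharp_dual a : sharp (dual J a) = J (sharp a).
  rewrite -[RHS]flatK; congr (sharp _); apply: form_eqP => Y /=.
  by rewrite gJ -{1}[a]sharpK.
have flat_J X : flat g (J X) = dual J (flat g X).
  by apply: form_eqP => Y; apply: gJ.
move=> [X a]; congr pair; rewrite /=.
  rewrite [sharp (_ - _)]raddfB /= flatK sharp_dual !(raddfD, raddfN) /= opprK.
  have -> (u v w : vectorField) : X - v + (- u + w) = X - (u + (v - w)).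
    by rewrite -addrA !opprD opprK; congr (X + _); rewrite addrCA.
  by rewrite addrC subrK.
by rewrite !(raddfD, raddfN) /= !flat_J sharpK -opprD addrCA addrK.
Qed.

End Algebra.

(* Main.v *)
Require Import Defs.
From mathcomp Require Import all_boot all_order all_algebra.
From mathcomp Require Import all_classical all_reals all_analysis.
Import GRing.Theory Num.Theory.

Local Open Scope ring_scope.

(** The connection acts on sections of TM (+) T^*M componentwise; write D for
    this action.  When nabla is torsion-free, the bracket is the
    antisymmetrisation of D along the vector parts:
      [s, t] = D_{s.1} t - D_{t.1} s          (nabla_bracketE).
    If moreover K commutes with every D_X, then expanding the Nijenhuis tensor
    of K and moving K outside all the derivatives makes the terms cancel in
    pairs, for instance D_{(K s).1} (K t) against K (D_{(K s).1} t)
    (parallel_nijenhuis).  So, for torsion-free nabla, every parallel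
    endomorphism is integrable, and it suffices that the four blocks of hatJp
    are parallel: J is so by assumption, J^* by duality, and the two musical
    isomorphisms because nabla g = 0. *)

Section ParallelEndomorphisms.
Context {R : realType} {n : nat} {M : smoothManifoldType R n}.
Implicit Types (X Y : vectorField M) (a b : oneForm M) (s t : genSection M).
Implicit Types (nabla : connection M) (g : riemannianMetric M) (J : tensor11 M).

Lemma vf_opposite X (f : smoothFun M) : X (- f) = - X f.
Proof.
have X0 : X 0 = 0 by apply: (addrI (X 0)); rewrite -vf_additive !addr0.
by apply/eqP; rewrite -addr_eq0 -vf_additive addNr X0.
Qed.

Lemma conn_opposite nabla X Y : nabla X (- Y) = - nabla X Y.
Proof.
have nX0 : nabla X 0 = 0.
  by apply: (addrI (nabla X 0)); rewrite -conn_additive !addr0.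
by apply/eqP; rewrite -addr_eq0 -conn_additive addNr nX0.
Qed.

Lemma nabla_form_sub nabla X a b :
  nabla_form nabla X (a - b) = nabla_form nabla X a - nabla_form nabla X b.
Proof.
apply: form_eqP => Y /=.
by rewrite vf_additive vf_opposite !opprD !opprK addrACA.
Qed.

(** Flat is parallel: evaluated on Z, this is the product rule for
    X (g Y Z) with the term in nabla X Z moved to the other side. *)
Lemma nabla_flat g nabla X Y : levi_civita g nabla ->
  nabla_form nabla X (flat g Y) = flat g (nabla X Y).
Proof. by case=> _ gP; apply: form_eqP => Z /=; rewrite gP addrK. Qed.

(** Sharp is parallel because it inverts the parallel map flat. *)
Lemma nabla_sharp g nabla (sharp : {linear oneForm M -> vectorField M}) X a :
  levi_civita g nabla -> cancel (flat g) sharp -> cancel sharp (flat g) ->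
  sharp (nabla_form nabla X a) = nabla X (sharp a).
Proof.
by move=> lc flatK sharpK; rewrite -{1}(sharpK a) (nabla_flat _ _ _ _ lc) flatK.
Qed.

Lemma nabla_tensor nabla J X Y : locally_metallic nabla J ->
  nabla X (J Y) = J (nabla X Y).
Proof. by move=> pJ; apply/eqP; rewrite -subr_eq0; apply/eqP/pJ. Qed.

Lemma nabla_dual nabla J X a : locally_metallic nabla J ->
  nabla_form nabla X (dual J a) = dual J (nabla_form nabla X a).
Proof. by move=> pJ; apply: form_eqP => Y /=; rewrite nabla_tensor. Qed.

Definition nabla_gen nabla X s : genSection M :=
  (nabla X s.1, nabla_form nabla X s.2).

(** On vector parts this is the torsion-free identity; on form parts it is the
    definition of the bracket. *)
Lemma nabla_bracketE nabla s t :
  (forall X Y, nabla X Y - nabla Y X = lie X Y) ->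
  nabla_bracket nabla s t = nabla_gen nabla s.1 t - nabla_gen nabla t.1 s.
Proof. by move=> torsion_free; rewrite /nabla_bracket -torsion_free. Qed.

(** Once K is moved outside the derivatives, the eight terms are a, b, c, d
    below, each occurring once with either sign. *)
Lemma parallel_nijenhuis nabla (K : {linear genSection M -> genSection M}) s t :
  (forall X Y, nabla X Y - nabla Y X = lie X Y) ->
  (forall X u, nabla_gen nabla X (K u) = K (nabla_gen nabla X u)) ->
  nijenhuis nabla K s t = 0.
Proof.
move=> torsion_free parK; rewrite /nijenhuis !nabla_bracketE// !parK.
rewrite !raddfB /=.
rewrite !opprK.
set a := K (nabla_gen _ (K s).1 t); set b := K (nabla_gen _ (K t).1 s).
set c := K (K (nabla_gen _ s.1 t)); set d := K (K _).
by rewrite [a - b]addrC [- c + b]addrC !addrA addrK subrK addrAC addrK addNr.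
Qed.

End ParallelEndomorphisms.

Theorem proposition2p11 (R : realType) (n : nat) (M : smoothManifoldType R n)
    (p q : R) (J : tensor11 M) (g : riemannianMetric M) (nabla : connection M)
    (sharp : {linear oneForm M -> vectorField M}) :
  metallic_riemannian p q J g ->
  levi_civita g nabla ->
  locally_metallic nabla J ->
  cancel (flat g) sharp -> cancel sharp (flat g) ->
  nabla_integrable nabla (hatJp J g sharp).
Proof.
move=> _ lc pJ flatK sharpK s t.
apply: parallel_nijenhuis => [|X [Y a]]; first by case: lc.
congr pair => /=.
  rewrite !conn_additive conn_opposite !(nabla_tensor _ _ _ _ pJ).
  by rewrite (nabla_sharp _ _ _ _ _ lc flatK sharpK).
by rewrite nabla_form_sub (nabla_flat _ _ _ _ lc) (nabla_dual _ _ _ _ pJ).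
Qed.
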